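(* Let $(M,\preceq)$ be a compact Hausdorff topological space equipped with a partial order $\preceq$ (no compatibility between the order and the topology is assumed beyond the hypotheses below). Let $I(M)$ be the set of all continuous functions $f:M\to\mathbb{R}$ that are non-decreasing, i.e. $x\preceq y$ implies $f(x)\le f(y)$. Let $A$ be the set of continuous non-decreasing piecewise linear functions from $\mathbb{R}$ to $\mathbb{R}$. Let $S$ be a non-empty subset of $I(M)$. Suppose that: (1) $S$ is stable by sum, i.e. $f+g\in S$ for all $f,g\in S$; (2) $A$ operates on $S$, i.e. $H\circ f\in S$ for all $H\in A$ and all $f\in S$; (3) $S$ generates $\preceq$, i.e. for all $x,y\in M$, $x\preceq y$ if and only if $f(x)\le f(y)$ for every $f\in S$. Then $S$ is dense in $I(M)$ for the uniform norm, i.e. for every $f\in I(M)$ and every $\varepsilon>0$ there exists $F\in S$ with $\sup_{m\in M}|f(m)-F(m)|\le\varepsilon$.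
   Context: $\mathbb{R}$ carries its usual topology and order. ''Piecewise linear'' means piecewise affine: $\mathbb{R}$ is divided into finitely many intervals on each of which the function is affine, $t\mapsto \alpha t+\beta$; in particular constant functions and all maps $t\mapsto \alpha t+\beta$ with $\alpha\ge 0$ belong to $A$. *)

(* Defs.v *)
From HB Require Import structures.
From mathcomp Require Import all_boot all_order all_algebra.
From mathcomp Require Import all_classical all_reals all_analysis.

Set Implicit Arguments.
Unset Strict Implicit.
Unset Printing Implicit Defensive.

Import Order.TTheory GRing.Theory Num.Theory.
Import numFieldNormedType.Exports.

Local Open Scope classical_set_scope.
Local Open Scope ring_scope.

(* [POrderedTopological.type d] is a topological space with a partial order
   and no compatibility axiom between the two (unlike [orderTopologicalType]).
   It need not be pointed, so [M] may be empty. *)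
Definition continuous_isotone (R : realType) (d : Order.disp_t)
    (M : POrderedTopological.type d) : set (M -> R) :=
  [set f | continuous f /\ {homo f : x y / (x <= y)%O >-> x <= y}].

(* The intervals may be open, closed or half-open, bounded or not; empty ones
   are harmless. *)
Definition piecewise_affine (R : realType) (H : R -> R) : Prop :=
  exists (n : nat) (J : 'I_n -> interval R),
    [/\ \bigcup_(i in [set: 'I_n]) [set` J i] = [set: R],
        trivIset [set: 'I_n] (fun i => [set` J i]) &
        forall i, exists a b : R, forall t, t \in J i -> H t = a * t + b].

Definition isotone_piecewise_affine (R : realType) : set (R -> R) :=
  [set H | [/\ continuous H, {homo H : s t / s <= t} & piecewise_affine H]].

(* Valued in the extended reals, hence meaningful without a boundedness proof;
   it is -oo when [M] is empty. *)
Definition sup_dist (R : realType) (M : Type) (f g : M -> R) : \bar R :=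
  ereal_sup [set `|f m - g m|%:E | m in [set: M]].

(* Main.v *)
Require Import Defs.
From HB Require Import structures.
From mathcomp Require Import all_boot all_order all_algebra.
From mathcomp Require Import all_classical all_reals all_analysis.
From mathcomp Require Import lra.

Set Implicit Arguments.
Unset Strict Implicit.
Unset Printing Implicit Defensive.

Import Order.TTheory GRing.Theory Num.Theory.
Import numFieldNormedType.Exports.

Local Open Scope classical_set_scope.
Local Open Scope ring_scope.

(** The proof is a Urysohn argument in which sums and truncations replace the
    lattice operations of the usual Stone-Weierstrass proof.

    Write [A] and [B] for two subsets of [M], and say that [S] separates them
    when some [g] in [S] with values in [[0, 1]] is 1 on [A] and 0 on [B].  Let
    [clamp01] be the retraction of the line onto [[0, 1]].  If [g1] and [g2]
    separate [A1] and [A2] from [B], then [clamp01 (g1 + g2)] separates the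
    union of [A1] and [A2] from [B]; dually, if [g1] and [g2] separate [A] from
    [B1] and [B2], then [clamp01 (g1 + g2 - 1)] separates [A] from the union of
    [B1] and [B2] ([separated_setUl], [separated_setIU]).  Both operations stay
    in [S].

    If [f] is isotone and [f y < f x], then [x <= y] fails, so some [g] in [S]
    has [g y < g x], and truncating an affine image of [g] separates a
    neighbourhood of [x] from a neighbourhood of [y] ([separated_nbhs]).
    Compactness, used once for [y] and once for [x], upgrades this to the
    separation of [f >= t] from [f <= s] whenever [s < t]
    ([separated_levels]).

    Finally, [f] is uniformly within [e] of the staircase
    [a + e * u_0 + ... + e * u_(n-1)], where [f] takes its values
    between [a] and [a + n * e], and [u_k] separates [f >= a + (k + 1) * e] from
    [f <= a + k * e]: at a given point [u_k] is 1 for the steps below the value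
    of [f] and 0 for those above it, so that only the step containing this
    value contributes an error ([staircase]). *)

(** * Compactness *)

(** The sets [~` A] with [P A] generate a filter; were [P K] false, its trace on
    [K] would be proper, and a cluster point of it in [K] would have no
    neighbourhood satisfying [P]. *)
Lemma compact_set_ind (T : topologicalType) (K : set T) (P : set T -> Prop) :
  compact K -> P set0 ->
  (forall A B, P A -> P B -> P (A `|` B)) ->
  (forall A B, A `<=` B -> P B -> P A) ->
  (forall x, K x -> exists2 U, nbhs x U & P U) ->
  P K.
Proof.
move=> cK P0 PU Psub Ploc; apply: contrapT => nPK.
pose G : set_system T := [set U | exists2 A, P A & K `\` A `<=` U].
have GF : ProperFilter G.
  split.
    move=> [A PA KA]; apply/nPK/(Psub _ A) => // x Kx.
    by apply: contrapT => nAx; apply: (KA x).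
  split.
  - by exists set0.
  - move=> U V [A PA KA] [B PB KB]; exists (A `|` B); first exact: PU.
    move=> x [Kx nAB]; split.
      by apply: KA; split => // Ax; apply: nAB; left.
    by apply: KB; split => // Bx; apply: nAB; right.
  - by move=> U V UV [A PA KA]; exists A => // x /KA /UV.
have GK : G K by exists set0 => // x [].
have [x [Kx clx]] := cK G GF GK.
have [U nU PU'] := Ploc x Kx.
have GU : G (~` U) by exists U => // y [].
by have [y [nUy Uy]] := clx _ _ GU nU.
Qed.

(** * Piecewise affine maps *)

Section PiecewiseAffine.
Variable R : realType.

Lemma isotone_piecewise_affine_affine (a b : R) : 0 <= a ->
  isotone_piecewise_affine (fun t => a * t + b).
Proof.
move=> a0; split.
- by move=> t; apply: cvgD; [apply: cvgM; [exact: cvg_cst|exact: cvg_id]|exact: cvg_cst].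
- by move=> s t st; rewrite lerD2r ler_wpM2l.
- exists 1%N, (fun=> `]-oo, +oo[); split.
  + by apply/seteqP; split => // t _; exists ord0 => //=; rewrite in_itv.
  + by move=> i j _ _ _; rewrite !ord1.
  + by move=> i; exists a, b.
Qed.

Definition clamp01 (t : R) : R := Num.min 1 (Num.max 0 t).

Lemma clamp01_ge0 t : 0 <= clamp01 t.
Proof. by rewrite le_min ler01 le_max lexx. Qed.

Lemma clamp01_le1 t : clamp01 t <= 1.
Proof. by rewrite ge_min lexx. Qed.

Lemma clamp01_eq0 t : t <= 0 -> clamp01 t = 0.
Proof. by move=> t0; rewrite /clamp01 (max_idPl t0); apply/min_idPr/ler01. Qed.

Lemma clamp01_eq1 t : 1 <= t -> clamp01 t = 1.
Proof. by move=> t1; apply/min_idPl; rewrite le_max t1 orbT. Qed.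

Lemma clamp01_id t : 0 <= t <= 1 -> clamp01 t = t.
Proof. by case/andP=> t0 t1; rewrite /clamp01 (max_idPr t0); apply/min_idPr. Qed.

Lemma isotone_piecewise_affine_clamp01 : isotone_piecewise_affine clamp01.
Proof.
split.
- move=> t; apply: continuous_min; first exact: cvg_cst.
  by apply: continuous_max; [exact: cvg_cst|exact: cvg_id].
- move=> s t st; rewrite /clamp01 le_min ge_min lexx /= ge_min; apply/orP; right.
  by rewrite ge_max !le_max lexx st orbT.
pose J (i : 'I_3) : interval R :=
  match val i with 0%N => `]-oo, 0[ | 1%N => `[0, 1] | _ => `]1, +oo[ end.
exists 3%N, J; split.
- apply/seteqP; split => // t _.
  have [t0|t0] := ltP t 0.
    by exists (@Ordinal 3 0 isT) => //=; rewrite in_itv.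
  have [t1|t1] := leP t 1.
    by exists (@Ordinal 3 1 isT) => //=; rewrite in_itv /= t0.
  by exists (@Ordinal 3 2 isT) => //=; rewrite in_itv /= t1.
- move=> [[|[|[|//]]] i3] [[|[|[|//]]] j3] _ _ [t []] /=;
    rewrite /J /= !in_itv /= ?andbT => ti tj; try exact: val_inj; exfalso; lra.
- move=> [[|[|[|//]]] i3]; rewrite /J /=.
  + exists 0, 0 => t; rewrite in_itv /= => t0.
    by rewrite clamp01_eq0 ?(ltW t0)// mul0r addr0.
  + by exists 1, 0 => t; rewrite in_itv /= => /clamp01_id ->; rewrite mul1r addr0.
  + exists 0, 1 => t; rewrite in_itv /= andbT => t1.
    by rewrite clamp01_eq1 ?(ltW t1)// mul0r add0r.
Qed.

End PiecewiseAffine.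

(** * Separation by members of a stable family *)

Section Separation.
Variables (R : realType) (T : Type) (S : set (T -> R)).
Hypothesis S_nonempty : S !=set0.
Hypothesis S_sum : forall f g, S f -> S g -> S (fun m => f m + g m).
Hypothesis S_operates : forall H f,
  @isotone_piecewise_affine R H -> S f -> S (H \o f).

Lemma stable_affine (a b : R) g : 0 <= a -> S g -> S (fun m => a * g m + b).
Proof.
by move=> a0 Sg; apply: (S_operates (isotone_piecewise_affine_affine b a0) Sg).
Qed.

Lemma stable_clamp01 g : S g -> S (fun m => clamp01 (g m)).
Proof. exact: (S_operates (isotone_piecewise_affine_clamp01 R)). Qed.

Lemma stable_cst (c : R) : S (fun=> c).
Proof.
have [g Sg] := S_nonempty.
have := stable_affine c (lexx 0) Sg.
by under eq_fun do rewrite mul0r add0r.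
Qed.

Definition separated (A B : set T) : Prop :=
  exists g, [/\ S g, forall m, 0 <= g m <= 1,
    forall m, A m -> g m = 1 & forall m, B m -> g m = 0].

Lemma separated_clamp01 g (A B : set T) : S g ->
  (forall m, A m -> 1 <= g m) -> (forall m, B m -> g m <= 0) -> separated A B.
Proof.
move=> Sg gA gB; exists (fun m => clamp01 (g m)); split.
- exact: stable_clamp01.
- by move=> m; rewrite clamp01_ge0 clamp01_le1.
- by move=> m /gA /clamp01_eq1.
- by move=> m /gB /clamp01_eq0.
Qed.

Lemma separated_subset (A A' B B' : set T) :
  A `<=` A' -> B `<=` B' -> separated A' B' -> separated A B.
Proof.
move=> AA BB [g [Sg g01 gA gB]].
by exists g; split=> // m; [move/AA; apply: gA|move/BB; apply: gB].
Qed.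

Lemma separated_set0l B : separated set0 B.
Proof. by apply: (@separated_clamp01 (fun=> 0)) => //; exact: stable_cst. Qed.

Lemma separated_set0r A : separated A set0.
Proof. by apply: (@separated_clamp01 (fun=> 1)) => //; exact: stable_cst. Qed.

(** A truncated sum does the work of a maximum. *)
Lemma separated_setUl A1 A2 B :
  separated A1 B -> separated A2 B -> separated (A1 `|` A2) B.
Proof.
move=> [g [Sg g01 gA gB]] [h [Sh h01 hA hB]].
apply: (separated_clamp01 (S_sum Sg Sh)) => m.
  by move: (g01 m) (h01 m) => ? ? [/gA|/hA] ->; lra.
by move=> Bm; rewrite gB // hB // addr0.
Qed.

(** Dually, the truncation of [g + h - 1] does the work of a minimum: it is at
    most 0 as soon as one of the two vanishes, and 1 where both are 1. *)
Lemma separated_setIU A1 A2 B1 B2 :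
  separated A1 B1 -> separated A2 B2 -> separated (A1 `&` A2) (B1 `|` B2).
Proof.
move=> [g [Sg g01 gA gB]] [h [Sh h01 hA hB]].
apply: (separated_clamp01 (S_sum (S_sum Sg Sh) (stable_cst (-1)))) => m.
  by move=> [/gA -> /hA ->]; lra.
by move: (g01 m) (h01 m) => ? ? [/gB|/hB] ->; lra.
Qed.

(** Raising the approximation by one truncated step at a time.  The second
    conjunct says that above the last level the staircase is exactly at its
    top, which is what lets the next step start from the right height. *)
Lemma staircase (f : T -> R) (a e : R) (n : nat) :
  0 < e -> (forall m, a <= f m) ->
  (forall s t, s < t -> separated [set m | t <= f m] [set m | f m <= s]) ->
  exists2 F, S F & forall m,
    (f m <= a + n%:R * e -> `|f m - F m| <= e) /\
    (a + n%:R * e <= f m -> F m = a + n%:R * e).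
Proof.
move=> e0 af sep; elim: n => [|n [F SF FP]].
  exists (fun=> a); first exact: stable_cst.
  move=> m; rewrite mul0r addr0; split=> // fa.
  have -> : f m = a by apply/eqP; rewrite eq_le fa af.
  by rewrite subrr normr0 ltW.
have step : a + n%:R * e < a + n.+1%:R * e by rewrite -natr1; lra.
have [u [Su u01 u1 u0]] := sep _ _ step.
exists (fun m => F m + (e * u m + 0)).
  by apply: S_sum => //; apply: stable_affine => //; exact: ltW.
move=> m; have [FP1 FP2] := FP m; rewrite addr0.
have [fn|fn] := leP (f m) (a + n%:R * e).
  rewrite u0 // mulr0 addr0; split=> [_|]; first exact: FP1.
  by move=> fn'; have := lt_le_trans step (le_trans fn' fn); rewrite ltxx.
rewrite (FP2 (ltW fn)); split=> [fn1|fn1]; last first.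
  by rewrite u1 // -natr1; lra.
have /andP[um0 um1] := u01 m.
have : 0 <= e * u m by rewrite mulr_ge0 // ltW.
have : e * u m <= e by rewrite ger_pMr.
by move: fn1; rewrite -natr1 => ? ? ?; rewrite ler_norml; apply/andP; split; lra.
Qed.

End Separation.

(** * From the order to level sets *)

(** The thirds of the gap between [g y] and [g x] leave room on both sides for
    the truncation to be constant near [x] and near [y]. *)
Lemma separated_nbhs (R : realType) (T : topologicalType) (S : set (T -> R))
    (S_operates : forall H f, @isotone_piecewise_affine R H -> S f -> S (H \o f))
    (g : T -> R) (x y : T) :
  S g -> continuous g -> g y < g x ->
  exists U V, [/\ nbhs x U, nbhs y V & separated S U V].
Proof.
move=> Sg cg gyx.
pose w := g x - g y.
have w0 : 0 < w by rewrite subr_gt0.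
exists [set m | g y + w * (2 / 3) < g m], [set m | g m < g y + w / 3]; split.
- by apply: (cg x [set r | g y + w * (2 / 3) < r]); apply: lt_nbhsr; rewrite /w in w0 *; lra.
- by apply: (cg y [set r | r < g y + w / 3]); apply: lt_nbhsl; lra.
- have a0 : 0 <= 3 / w by rewrite divr_ge0 // ltW.
  have w3 : 3 / w * w = 3 by rewrite divfK // gt_eqF.
  have S_aff := stable_affine S_operates (- (3 / w * g y) - 1) a0 Sg.
  apply: (separated_clamp01 S_operates S_aff) => m /= /ltW gm;
    by have := ler_wpM2l a0 gm; rewrite mulrDr mulrA w3; lra.
Qed.

Section Levels.
Variables (R : realType) (d : Order.disp_t) (M : POrderedTopological.type d).
Hypothesis M_compact : compact [set: M].
Variable S : set (M -> R).
Hypothesis S_nonempty : S !=set0.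
Hypothesis S_sub : S `<=` @continuous_isotone R d M.
Hypothesis S_sum : forall f g, S f -> S g -> S (fun m => f m + g m).
Hypothesis S_operates : forall H f,
  @isotone_piecewise_affine R H -> S f -> S (H \o f).
Hypothesis S_generates : forall x y : M,
  (forall f, S f -> f x <= f y) -> (x <= y)%O.

(** The Urysohn lemma for [S]: the inner induction makes the lower level set
    the second term of the separation, at the price of shrinking the
    neighbourhood of [x]; the outer one then collects these neighbourhoods. *)
Lemma separated_levels (f : M -> R) (s t : R) :
  continuous f -> {homo f : x y / (x <= y)%O >-> x <= y} -> s < t ->
  separated S [set m | t <= f m] [set m | f m <= s].
Proof.
move=> cf hf st.
have compact_preimage (C : set R) : closed C -> compact (f @^-1` C).
  move=> clC; apply: (subclosed_compact _ M_compact) => //.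
  by apply: closed_comp => // m _; exact: cf.
apply: (@compact_set_ind _ _ (fun A => separated S A [set m | f m <= s])).
- by apply: (compact_preimage [set r | t <= r]); exact: closed_ge.
- exact: separated_set0l.
- by move=> A B; exact: separated_setUl.
- by move=> A B AB; exact: separated_subset.
move=> x /= tx.
apply: (@compact_set_ind _ _ (fun B => exists2 U, nbhs x U & separated S U B)).
- by apply: (compact_preimage [set r | r <= s]); exact: closed_le.
- by exists setT; [exact: filterT|exact: separated_set0r].
- move=> A B [U nU sU] [V nV sV]; exists (U `&` V); first exact: filterI.
  exact: separated_setIU.
- by move=> A B AB [U nU sU]; exists U => //; apply: separated_subset sU.
move=> y /= ys.
have [g Sg gyx] : exists2 g, S g & g y < g x.
  apply: contrapT => noS.
  have /hf : (x <= y)%O.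
    apply: S_generates => g Sg; rewrite leNgt; apply/negP => gyx.
    by apply: noS; exists g.
  by move=> fxy; have := le_lt_trans (le_trans tx fxy) (le_lt_trans ys st); rewrite ltxx.
have [U [V [nU nV sUV]]] := separated_nbhs S_operates Sg (S_sub Sg).1 gyx.
by exists V => //; exists U.
Qed.

End Levels.

(** * Density *)

Theorem theorem3p1 (R : realType) (d : Order.disp_t)
    (M : POrderedTopological.type d)
    (M_compact : compact [set: M]) (M_hausdorff : hausdorff_space M)
    (S : set (M -> R))
    (S_nonempty : S !=set0)
    (S_sub : S `<=` @continuous_isotone R d M)
    (S_sum : forall f g, S f -> S g -> S (fun m => f m + g m))
    (S_operates : forall H f,
       @isotone_piecewise_affine R H -> S f -> S (H \o f))
    (S_generates : forall x y : M,
       (x <= y)%O <-> (forall f, S f -> f x <= f y)) :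
  forall f, @continuous_isotone R d M f ->
  forall e : R, 0 < e ->
  exists2 F, S F & (sup_dist f F <= e%:E)%E.
Proof.
move=> f [cf hf] e e0.
have [b fb] : exists b, forall m, `|f m| <= b.
  have /compact_bounded [b0 [_ fb]] : compact (f @` [set: M]).
    by apply: continuous_compact => //; exact: continuous_subspaceT.
  exists (b0 + 1) => m; apply: (fb (b0 + 1)); first by rewrite ltrDl.
  by exists m.
have af m : - b <= f m by have := fb m; rewrite ler_norml => /andP[].
(* [n] steps of height [e] climb from [- b] past [b]. *)
pose n := Num.bound `|2 * b / e|.
have bn : b <= - b + n%:R * e.
  have : 2 * b < n%:R * e.
    rewrite -ltr_pdivrMr //; apply: le_lt_trans (ler_norm _) _.
    exact/archi_boundP/normr_ge0.
  by lra.
have sep := fun s t => @separated_levels _ _ _ M_compact _ S_nonempty S_sub S_sum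
  S_operates (fun x y => (S_generates x y).2) f s t cf hf.
have [F SF FP] := staircase S_nonempty S_sum S_operates n e0 af sep.
exists F => //; apply: ge_ereal_sup => _ [m _ <-]; rewrite lee_fin.
by apply: (FP m).1; apply: le_trans bn; exact: le_trans (ler_norm _) (fb m).
Qed.
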